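(* Let $\mathcal C=\mathcal C(I,A,(\rho_i)_{i\in I},(C^a)_{a\in A})$ be a Cartan scheme such that $\mathcal R^{\mathrm{re}}(\mathcal C)$ is a finite root system of type $\mathcal C$. Let $a\in A$, and consider $\operatorname{Hom}(\mathcal W(\mathcal C),a)$ with the weak order $\le_R$, with meet $\wedge$, join $\vee$, least element $\hat 0=\mathrm{id}^a$ and greatest element $\hat 1=w_I$. Then the map $\perp:\operatorname{Hom}(\mathcal W(\mathcal C),a)\to\operatorname{Hom}(\mathcal W(\mathcal C),a)$ defined by $w^\perp:=w w_I$ satisfies: (O1) $w\wedge w^\perp=\hat 0$ for all $w$; (O2) $w\vee w^\perp=\hat 1$ for all $w$; (O3) $(w^\perp)^\perp=w$ for all $w$; (O4) $v^\perp\le_R u^\perp$ for all $u\le_R v$. Thus $\operatorname{Hom}(\mathcal W(\mathcal C),a)$ with the weak order is an ortho-complemented lattice.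
   Context: Cartan schemes. Let $I,A$ be finite sets, $A\neq\emptyset$, and $(\alpha_i)_{i\in I}$ the standard basis of $\mathbb Z^I$. A Cartan scheme $\mathcal C=\mathcal C(I,A,(\rho_i)_{i\in I},(C^a)_{a\in A})$ consists of maps $\rho_i:A\to A$ ($i\in I$) and (integer) generalized Cartan matrices $C^a=(c^a_{jk})_{j,k\in I}$ ($a\in A$) such that $\rho_i^2=\mathrm{id}$ and $c^a_{ij}=c^{\rho_i(a)}_{ij}$ for all $a\in A$, $i,j\in I$. Define $\sigma_i^a\in\operatorname{Aut}(\mathbb Z^I)$ by $\sigma_i^a(\alpha_j)=\alpha_j-c^a_{ij}\alpha_i$ for all $j\in I$. Weyl groupoid. $\mathcal W(\mathcal C)$ is the category (a groupoid) with object set $A$ whose morphisms are the compositions of the maps $\sigma_i^a$, each regarded as an element of $\operatorname{Hom}(a,\rho_i(a))$ (morphisms with the same source and target are equal iff they are equal as linear maps). Upper indices are omitted when determined by context; $\mathrm{id}^a\sigma_{i_1}\cdots\sigma_{i_k}$ denotes the composition with target $a$. $\operatorname{Hom}(\mathcal W(\mathcal C),a)$ is the disjoint union $\bigcup_{b\in A}\operatorname{Hom}(b,a)$. Roots. $(R^{\mathrm{re}})^a=\{\mathrm{id}^a\sigma_{i_1}\cdots\sigma_{i_k}(\alpha_j)\mid k\ge 0,\ i_1,\dots,i_k,j\in I\}$, and $\mathcal R^{\mathrm{re}}(\mathcal C)=(\mathcal C,((R^{\mathrm{re}})^a)_{a\in A})$. A family $(R^a)_{a\in A}$ of subsets of $\mathbb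 Z^I$ is a root system of type $\mathcal C$ if, with $R^a_+=R^a\cap\mathbb N_0^I$ and $m^a_{i,j}=|R^a\cap(\mathbb N_0\alpha_i+\mathbb N_0\alpha_j)|$: (R1) $R^a=R^a_+\cup -R^a_+$; (R2) $R^a\cap\mathbb Z\alpha_i=\{\alpha_i,-\alpha_i\}$; (R3) $\sigma_i^a(R^a)=R^{\rho_i(a)}$; (R4) if $i\ne j$ and $m^a_{i,j}$ is finite then $(\rho_i\rho_j)^{m^a_{i,j}}(a)=a$; for all $a\in A$, $i,j\in I$. It is finite if every $R^a$ is finite. Length and weak order. For a morphism $w$, $\ell(w)$ is the least $k\ge0$ such that $w$ is a composition $\sigma_{i_1}\cdots\sigma_{i_k}^b$. For $u\in\operatorname{Hom}(b,a)$, $v\in\operatorname{Hom}(c,b)$ put $u\le_R uv$ iff $\ell(u)+\ell(v)=\ell(uv)$; this is a partial order on $\operatorname{Hom}(\mathcal W(\mathcal C),a)$ (weak order). Longest element. For each object $b$, $w_I$ denotes the unique maximal element of $\operatorname{Hom}(\mathcal W(\mathcal C),b)$ with respect to weak order; the notation suppresses $b$. In $ww_I$ with $w\in\operatorname{Hom}(b,a)$, $w_I$ is the one with target $b$. A lattice with least element $\hat 0$ and greatest element $\hat 1$ is ortho-complemented if it admits a map $\perp$ to itself satisfying (O1)–(O4). *)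

(* Defs.v *)
From HB Require Import structures.
From mathcomp Require Import all_boot all_order all_algebra.
From mathcomp Require Import boolp classical_sets functions cardinality.

Set Implicit Arguments.
Unset Strict Implicit.
Unset Printing Implicit Defensive.

Import Order.TTheory GRing.Theory.

Local Open Scope classical_set_scope.
Local Open Scope ring_scope.

Definition generalized_cartan_matrix (I : finType) (c : I -> I -> int) : Prop :=
  [/\ forall i, c i i = 2,
      forall i j, i != j -> c i j <= 0
    & forall i j, c i j = 0 -> c j i = 0].

Record cartan_scheme (I A : finType) := CartanScheme {
  rho : I -> A -> A;
  cmat : A -> I -> I -> int;
  objects_nonempty : (0 < #|A|)%N;
  cmat_gcm : forall a, generalized_cartan_matrix (cmat a);
  rho_invol : forall i a, rho i (rho i a) = a;
  cmat_rho : forall a i j, cmat a i j = cmat (rho i a) i j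
}.

(* int^o, rather than int, provides the module structure over int. *)
Notation ZI I := {ffun I -> int^o}.

Definition alpha (I : finType) (i : I) : ZI I := [ffun j => (j == i)%:R].

Section Groupoid.
Variables (I A : finType) (C : cartan_scheme I A).
Implicit Types (a b : A) (i j : I) (s t : seq I).

Definition sigma_fun i a (x : ZI I) : ZI I :=
  x - (\sum_j cmat C a i j * x j : int) *: alpha i.

Fact sigma_fun_linear i a : linear (sigma_fun i a).
Proof.
move=> k x y; rewrite /sigma_fun scalerBr scalerA addrACA -opprD -scalerDl.
congr (_ - _ *: _); rewrite mulr_sumr -big_split /=; apply: eq_bigr => j _.
by rewrite !ffunE mulrDr [cmat _ _ _ _ * _]mulrCA.
Qed.

HB.instance Definition _ i a :=
  GRing.isLinear.Build int (ZI I) (ZI I) _ (sigma_fun i a)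
    (sigma_fun_linear i a).

Definition sigma i a : 'End(ZI I) := linfun (sigma_fun i a).

(* sigma is given by its values on the standard basis: see sigma_alpha. *)
Lemma sigma_alpha i a j : sigma i a (alpha j) = alpha j - cmat C a i j *: alpha i.
Proof.
rewrite lfunE /= /sigma_fun (bigD1 j) //= big1 ?ffunE ?eqxx ?mulr1 ?addr0 //.
by move=> l /negPf nlj; rewrite ffunE nlj mulr0.
Qed.

(* The composition id^a sigma_{i_1} ... sigma_{i_k} with target a, for
   s = [:: i_1; ...; i_k]: its source, and its underlying linear map. As sigma_i
   goes from b to rho_i(b), the first factor is sigma_{i_1} at the object
   rho_{i_1}(a). *)
Fixpoint word_src a s : A :=
  if s is i :: s' then word_src (rho C i a) s' else a.

Fixpoint word_map a s : 'End(ZI I) :=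
  if s is i :: s' then (sigma i (rho C i a) \o word_map (rho C i a) s')%VF
  else \1%VF.

Definition word_eq b a (f : 'End(ZI I)) s : bool :=
  (word_src a s == b) && (word_map a s == f).

(* hom b a is Hom(b, a): source b, target a. *)
Record hom b a := Hom {
  hom_map :> 'End(ZI I);
  _ : `[< exists s, word_eq b a hom_map s >]
}.
HB.instance Definition _ b a := [isSub for @hom_map b a].
HB.instance Definition _ b a := [Choice of hom b a by <:].

Lemma homP b a (f : hom b a) : exists s, word_eq b a f s.
Proof. by case: f => f /= /asboolP. Qed.

Lemma word_src_cat a s t : word_src a (s ++ t) = word_src (word_src a s) t.
Proof. by elim: s a => //= i s IHs a; rewrite IHs. Qed.

Lemma word_map_cat a s t :
  word_map a (s ++ t) = (word_map a s \o word_map (word_src a s) t)%VF.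
Proof.
by elim: s a => [|i s IHs] a /=; rewrite ?comp_lfun1l // IHs comp_lfunA.
Qed.

Fact hom_id_subproof a : `[< exists s, word_eq a a \1%VF s >].
Proof. by apply/asboolP; exists [::]; rewrite /word_eq /= !eqxx. Qed.
Definition hom_id a : hom a a := Hom (hom_id_subproof a).

Fact hom_comp_subproof c b a (u : hom b a) (v : hom c b) :
  `[< exists s, word_eq c a (u \o v)%VF s >].
Proof.
apply/asboolP; have [s /andP[/eqP sb /eqP su]] := homP u.
have [t /andP[/eqP tc /eqP tv]] := homP v; exists (s ++ t).
by rewrite /word_eq word_src_cat word_map_cat sb tc su tv !eqxx.
Qed.
Definition hom_comp c b a (u : hom b a) (v : hom c b) : hom c a :=
  Hom (hom_comp_subproof u v).

Fact length_subproof b a (w : hom b a) :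
  exists k, [exists s : k.-tuple I, word_eq b a w s].
Proof. by have [s ws] := homP w; exists (size s); apply/existsP; exists (in_tuple s). Qed.
Definition length b a (w : hom b a) : nat := ex_minn (length_subproof w).

Definition hom_to a := {b : A & hom b a}.
HB.instance Definition _ a := Choice.on (hom_to a).

Definition mk_hom_to b a (w : hom b a) : hom_to a := Tagged (hom^~ a) w.
Definition hom_to_id a : hom_to a := mk_hom_to (hom_id a).

Definition weak_le a (u w : hom_to a) : Prop :=
  exists (c : A) (v : hom c (tag u)),
    w = mk_hom_to (hom_comp (tagged u) v) /\
    (length (tagged u) + length v = length (hom_comp (tagged u) v))%N.

Definition weak_maximal a (w : hom_to a) : Prop :=
  forall v : hom_to a, weak_le w v -> v = w.

(* The unique maximal element of hom_to a. It exists when the real roots form a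
   finite root system; otherwise xget may return its default, the identity. *)
Definition longest a : hom_to a :=
  xget (hom_to_id a) [set w | forall v, weak_maximal v <-> v = w].

Definition perp a (w : hom_to a) : hom_to a :=
  mk_hom_to (hom_comp (tagged w) (tagged (longest (tag w)))).

Definition real_roots a : set (ZI I) :=
  [set x : ZI I | exists s j, x = word_map a s (alpha j)].

Definition nonneg_vectors : set (ZI I) := [set x : ZI I | forall i, 0 <= (x i : int)].

Definition rank2_cone i j : set (ZI I) :=
  [set x : ZI I | exists m n : nat, x = alpha i *+ m + alpha j *+ n].

Definition is_root_system (R : A -> set (ZI I)) : Prop :=
  [/\ forall a, R a = (R a `&` nonneg_vectors) `|`
                      [set - x | x in R a `&` nonneg_vectors],
      forall a i, R a `&` [set alpha i *~ k | k in [set: int]] =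
                  [set alpha i; - alpha i],
      forall a i, [set sigma i a x | x in R a] = R (rho C i a)
    & forall a i j (m : nat), i != j ->
        (R a `&` rank2_cone i j #= `I_m)%card ->
        iter m (rho C i \o rho C j) a = a].

Definition is_finite_root_system (R : A -> set (ZI I)) : Prop :=
  is_root_system R /\ forall a, finite_set (R a).

End Groupoid.

Arguments hom_to {I A} C a.
Arguments hom_to_id {I A} C a.
Arguments longest {I A} C a.
Arguments real_roots {I A} C a.

Definition is_orthocomplement (d : Order.disp_t) (L : tbLatticeType d)
    (p : L -> L) : Prop :=
  [/\ forall w, (w `&` p w)%O = \bot%O,
      forall w, (w `|` p w)%O = \top%O,
      forall w, p (p w) = w
    & forall u v, (u <= v)%O -> (p v <= p u)%O].

(* The order determines the meet and the join of M, so this fixes M up to its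
   choice structure. *)
Definition is_lattice_for (d : Order.disp_t) (T : Type)
    (M : Order.TBLattice.axioms_ d T) (le : T -> T -> Prop) (bot top : T) : Prop :=
  let L : tbLatticeType d := Order.TBLattice.Pack M in
  [/\ forall u v : L, (u <= v)%O <-> le u v,
      (\bot : L)%O = bot
    & (\top : L)%O = top].

(* Main.v *)
(* Attach to a word s with target a its set of inversions: the positive roots at
   a that the inverse of s makes negative. A simple reflection permutes the
   positive roots other than its own simple root, so inversion sets behave as in
   a Coxeter group, and by (R4) the two alternating words in i and j of length
   |R_+ inter <alpha_i, alpha_j>| agree (braid relation). By a Matsumoto type
   induction a morphism is determined by its inversion set, whose cardinal is the
   length, and the weak order becomes inclusion of inversion sets. The longest
   element inverts every positive root, so perp complements inversion sets. Joins
   exist by the criterion of Bjorner, Edelman and Ziegler, since the covers z i and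
   z j of z have a join; perp turns joins into meets. *)
From HB Require Import structures.
Require Import Defs.
From mathcomp Require Import all_boot all_order all_algebra finmap.
From mathcomp Require Import boolp classical_sets cardinality.
From mathcomp Require Import zify ring.

Set Implicit Arguments.
Unset Strict Implicit.
Unset Printing Implicit Defensive.

Import Order.TTheory GRing.Theory Num.Theory.

Local Open Scope fset_scope.
Local Open Scope ring_scope.

(** * Nonnegative vectors *)

Section Vectors.
Variable I : finType.
Implicit Types (i j k : I) (x y : ZI I).

Definition nonneg x : bool := [forall i, 0 <= (x i : int)].

Lemma nonnegP x : reflect (forall i, 0 <= (x i : int)) (nonneg x).
Proof. exact: forallP. Qed.

Lemma alphaE i k : (alpha i k : int) = (k == i)%:R.
Proof. by rewrite ffunE. Qed.

Lemma nonneg_alpha i : nonneg (alpha i).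
Proof. by apply/nonnegP => k; rewrite alphaE; case: eqP. Qed.

Lemma vec_sum x : x = \sum_i (x i : int) *: alpha i.
Proof.
apply/ffunP => k; rewrite sum_ffunE (bigD1 k) //= big1 ?addr0 => [|i nik].
  by rewrite ffunE alphaE eqxx /= /GRing.scale /= mulr1.
by rewrite ffunE alphaE eq_sym (negPf nik) /GRing.scale /= mulr0.
Qed.

Lemma lfun_sum (f : 'End(ZI I)) x : f x = \sum_i (x i : int) *: f (alpha i).
Proof. by rewrite {1}(vec_sum x) linear_sum; apply: eq_bigr => i _; rewrite linearZ. Qed.

(** Restricting to the support of [x] lets signs of roots in a rank two plane be read from two
    simple roots only. *)
Lemma lfun_nonneg (f : 'End(ZI I)) x : nonneg x ->
  (forall i, x i != 0 -> nonneg (f (alpha i))) -> nonneg (f x).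
Proof.
move=> /nonnegP x0 fx; apply/nonnegP => k; rewrite lfun_sum sum_ffunE.
apply: sumr_ge0 => i _; rewrite ffunE; have [->|/fx/nonnegP] := eqVneq (x i) 0.
  by rewrite scale0r.
by move=> /(_ k) ?; apply: mulr_ge0.
Qed.

Lemma lfun_alpha_eq (f g : 'End(ZI I)) : (forall i, f (alpha i) = g (alpha i)) -> f = g.
Proof.
move=> fg; apply/lfunP => x; rewrite lfun_sum [RHS]lfun_sum.
by apply: eq_bigr => i _; rewrite fg.
Qed.

Lemma nonneg_anti x : nonneg x -> nonneg (- x) -> x = 0.
Proof.
move=> /nonnegP x0 /nonnegP x1; apply/ffunP => k; rewrite ffunE.
by have := x0 k; have := x1 k; rewrite ffunE oppr_ge0 => *; apply/le_anti/andP.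
Qed.

End Vectors.

(** * Words and roots *)

Section Words.
Variables (I A : finType) (C : cartan_scheme I A).
Implicit Types (a b c : A) (i j k : I) (s t p : seq I) (x y : ZI I).

Local Notation src := (word_src C).
Local Notation wmap := (word_map C).
Local Notation rho := (rho C).

Lemma sigma_coord i a x k : k != i -> sigma C i a x k = x k.
Proof.
by move=> ki; rewrite lfunE /= /sigma_fun !ffunE (negPf ki) scaler0 subr0.
Qed.

Lemma sigma_alphai i a : sigma C i a (alpha i) = - alpha i.
Proof.
rewrite sigma_alpha; have [-> _ _] := cmat_gcm C a.
by rewrite (scalerDl (alpha i) 1 1) scale1r opprD addrA subrr add0r.
Qed.

(** Row [i] of the Cartan matrix is the same at [a] and [rho i a], so both reflections are given by
    one formula, an involution. *)
Lemma sigmaK i a x : sigma C i (rho i a) (sigma C i a x) = x.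
Proof.
suff E : (sigma C i (rho i a) \o sigma C i a)%VF = \1%VF.
  by rewrite -comp_lfunE E id_lfunE.
apply: lfun_alpha_eq => j; rewrite comp_lfunE id_lfunE sigma_alpha linearB linearZ /=.
by rewrite sigma_alpha sigma_alphai -cmat_rho scalerN opprK subrK.
Qed.

Lemma sigmaVK i a x : sigma C i a (sigma C i (rho i a) x) = x.
Proof. by rewrite -{1}[a](rho_invol C i) sigmaK. Qed.

(** The inverse of [word_map], by recursion on the word so that it unfolds with the first letter;
    [wmap_rev] identifies it with the map of the reversed word. *)
Fixpoint winv a s : 'End(ZI I) :=
  if s is i :: s' then (winv (rho i a) s' \o sigma C i a)%VF else \1%VF.

Lemma winvK a s x : wmap a s (winv a s x) = x.
Proof.
elim: s a x => [|i s IHs] a x /=; rewrite ?id_lfunE // !comp_lfunE IHs.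
exact: sigmaK.
Qed.

Lemma wmapK a s x : winv a s (wmap a s x) = x.
Proof.
by elim: s a x => [|i s IHs] a x /=; rewrite ?id_lfunE // !comp_lfunE sigmaVK IHs.
Qed.

Lemma winv_cat a s t x : winv a (s ++ t) x = winv (src a s) t (winv a s x).
Proof.
by elim: s a x => [|i s IHs] a x /=; rewrite ?id_lfunE // !comp_lfunE IHs.
Qed.

Lemma wmap_cat a s t x : wmap a (s ++ t) x = wmap a s (wmap (src a s) t x).
Proof. by rewrite word_map_cat comp_lfunE. Qed.

Lemma src_rev a s : src (src a s) (rev s) = a.
Proof.
elim: s a => //= i s IHs a.
by rewrite rev_cons -cats1 word_src_cat IHs /= rho_invol.
Qed.

Lemma wmap_rev a s x : wmap (src a s) (rev s) x = winv a s x.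
Proof.
elim: s a x => //= i s IHs a x; rewrite rev_cons -cats1 wmap_cat src_rev /=.
by rewrite !comp_lfunE id_lfunE rho_invol IHs.
Qed.

Lemma winv_rev a s x : winv (src a s) (rev s) x = wmap a s x.
Proof. by rewrite -[RHS](wmapK (src a s) (rev s)) wmap_rev wmapK. Qed.

(** The word [rev s ++ t] stands for the quotient $s^{-1}t$ throughout. *)
Lemma winv_catl a s t x : winv (src a s) (rev s ++ t) x = winv a t (wmap a s x).
Proof. by rewrite winv_cat src_rev winv_rev. Qed.

Definition word_equiv a s t := src a s = src a t /\ wmap a s = wmap a t.

Lemma word_equiv_refl a s : word_equiv a s s.
Proof. by []. Qed.

Lemma word_equiv_sym a s t : word_equiv a s t -> word_equiv a t s.
Proof. by rewrite /word_equiv; case=> -> ->. Qed.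

Lemma word_equiv_trans a s t p :
  word_equiv a s t -> word_equiv a t p -> word_equiv a s p.
Proof. by rewrite /word_equiv; move=> [-> ->] [-> ->]. Qed.

Lemma word_equiv_cons a i s t :
  word_equiv (rho i a) s t -> word_equiv a (i :: s) (i :: t).
Proof. by rewrite /word_equiv /=; case=> -> ->. Qed.

Lemma word_equiv_catr a s t p :
  word_equiv a s t -> word_equiv a (s ++ p) (t ++ p).
Proof. by rewrite /word_equiv !word_src_cat !word_map_cat; case=> -> ->. Qed.

Lemma word_equiv_winv a s t : word_equiv a s t -> winv a s = winv a t.
Proof.
by case=> _ st; apply/lfunP => x; rewrite -[in LHS](winvK a t x) -st wmapK.
Qed.

Lemma word_equiv_consK a i s : word_equiv a (i :: i :: s) s.
Proof.
rewrite /word_equiv /= !rho_invol; split=> //; apply/lfunP => x.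
by rewrite !comp_lfunE sigmaK.
Qed.

Hypothesis hfin : is_finite_root_system C (real_roots C).
Local Notation root a := (real_roots C a).

Lemma root_sign a x : root a x -> nonneg x || nonneg (- x).
Proof.
have [[R1 _ _ _] _] := hfin; rewrite R1 => -[[_ /nonnegP->]//|[y [_ /nonnegP y0] <-]].
by rewrite opprK y0 orbT.
Qed.

Lemma root_opp a x : root a x -> root a (- x).
Proof.
have [[R1 _ _ _] _] := hfin; rewrite R1 => -[xp|[y yp <-]]; last by left; rewrite opprK.
by right; exists x.
Qed.

Lemma root_alpha a i : root a (alpha i).
Proof. by exists [::], i; rewrite id_lfunE. Qed.

Lemma root_wmap a s x : root (src a s) x -> root a (wmap a s x).
Proof. by case=> t [j ->]; exists (s ++ t), j; rewrite wmap_cat. Qed.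

Lemma root_winv a s x : root a x -> root (src a s) (winv a s x).
Proof. by move=> rx; rewrite -wmap_rev; apply: root_wmap; rewrite src_rev. Qed.

Lemma root_neq0 a x : root a x -> x != 0.
Proof.
case=> s [j ->]; apply/eqP => /(congr1 (winv a s)); rewrite wmapK linear0.
by move=> /ffunP/(_ j); rewrite alphaE eqxx ffunE.
Qed.

(** By (R1) one of the two signs is nonnegative, and both are not since a root is nonzero. *)
Lemma root_nonnegN a x : root a x -> nonneg (- x) = ~~ nonneg x.
Proof.
move=> rx; have /orP[xp|xn] := root_sign rx; last first.
  rewrite xn; apply/esym/negP => xp; have := root_neq0 rx.
  by rewrite (nonneg_anti xp xn) eqxx.
rewrite xp; apply/negP => xn; have := root_neq0 rx.
by rewrite (nonneg_anti xp xn) eqxx.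
Qed.

Definition proots a : {fset ZI I} := fset_set (root a `&` @nonneg_vectors I)%classic.

Lemma prootsP a x : reflect (root a x /\ nonneg x) (x \in proots a).
Proof.
have fin : finite_set (root a `&` @nonneg_vectors I)%classic.
  by have [_ /(_ a)] := hfin; apply: sub_finite_set => y [].
apply: (iffP idP); rewrite in_fset_set // inE.
  by move=> -[rx /nonnegP].
by move=> -[rx /nonnegP].
Qed.

Lemma proots_opp a x : root a x -> ~~ nonneg x -> - x \in proots a.
Proof.
by move=> rx xn; apply/prootsP; rewrite (root_nonnegN rx); split=> //; apply: root_opp.
Qed.

Lemma alpha_proots a i : alpha i \in proots a.
Proof. by apply/prootsP; split; [apply: root_alpha|apply: nonneg_alpha]. Qed.

(** A root supported at [i] alone is a multiple of [alpha i], so (R2) leaves only [alpha i] and its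
    opposite. *)
Lemma proots_supp a i x : x \in proots a -> x != alpha i -> exists2 k, k != i & x k != 0.
Proof.
move=> /prootsP[rx xp] xi; apply/exists_inP; apply: contraR xi.
rewrite negb_exists_in => /forall_inP xk.
have [[_ R2 _ _] _] := hfin.
have xE : x = alpha i *~ (x i : int).
  apply/ffunP => k; rewrite {1}(vec_sum x) (bigD1 i) //= big1 ?addr0.
    by rewrite -scaler_int /GRing.scale /= intz.
  by move=> l /xk; rewrite negbK => /eqP->; rewrite scale0r.
have : (root a `&` [set alpha i *~ k | k in [set: int]])%classic x.
  by split=> //; exists (x i : int).
rewrite R2 => -[->|/= xN] //; have := nonneg_alpha i.
by rewrite -[alpha i]opprK -xN (root_nonnegN rx) xp.
Qed.

(** The reflection changes the coordinate at [i] only, so a positive coordinate elsewhere survives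
    and fixes the sign of the image. *)
Lemma sigma_proots a i x :
  x \in proots a -> x != alpha i -> sigma C i a x \in proots (rho i a).
Proof.
move=> xP xi; have [k ki xk] := proots_supp xP xi.
have [rx /nonnegP xp] := prootsP _ _ xP.
have rs : root (rho i a) (sigma C i a x).
  by have := root_winv [:: i] rx; rewrite /= comp_lfunE id_lfunE.
apply/prootsP; split=> //; apply: contraTT isT => /negPf sp.
have := root_nonnegN rs; rewrite sp => /nonnegP/(_ k).
rewrite ffunE sigma_coord // oppr_ge0 => xk0.
by case/eqP: xk; apply/le_anti; rewrite xk0 xp.
Qed.

Lemma sigma_proots_neq a i x : x \in proots a -> sigma C i a x != alpha i.
Proof.
move=> /prootsP[rx xp]; apply/eqP => /(congr1 (sigma C i (rho i a))).
rewrite sigmaK sigma_alphai => xE; move: xp.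
by rewrite xE (root_nonnegN (root_alpha a i)) nonneg_alpha.
Qed.

(** * Inversion sets *)

Fact inversions_subproof : {N : A -> seq I -> {fset ZI I} | forall a s x,
  (x \in N a s) = (x \in proots a) && ~~ nonneg (winv a s x)}.
Proof.
by exists (fun a s => [fset x in proots a | ~~ nonneg (winv a s x)]) => a s x; rewrite !inE.
Qed.

(* Sealed, because unification would compare the matrices of the maps winv a s. *)
Definition inversions a s : {fset ZI I} := sval inversions_subproof a s.

Lemma in_inversions a s x :
  (x \in inversions a s) = (x \in proots a) && ~~ nonneg (winv a s x).
Proof. exact: (svalP inversions_subproof). Qed.

Lemma inversions_proots a s x : x \in inversions a s -> x \in proots a.
Proof. by rewrite in_inversions => /andP[]. Qed.

Lemma inversions_nil a : inversions a [::] = fset0.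
Proof.
apply/fsetP => x; rewrite in_inversions in_fset0 /= id_lfunE.
by apply/negP => /andP[/prootsP[_ ->]].
Qed.

(** The reflection permutes the positive roots other than [alpha i], whose own sign it flips: hence
    the negation in the first case. *)
Lemma inversions_cons a i s x : x \in proots a ->
  (x \in inversions a (i :: s)) =
  if x == alpha i then alpha i \notin inversions (rho i a) s
  else sigma C i a x \in inversions (rho i a) s.
Proof.
move=> xP; rewrite in_inversions xP /= comp_lfunE.
have [->|xi] := eqVneq x (alpha i); rewrite in_inversions.
  rewrite alpha_proots sigma_alphai linearN /= negbK.
  by rewrite (root_nonnegN (root_winv s (root_alpha (rho i a) i))) negbK.
by rewrite sigma_proots.
Qed.

Lemma alpha_inversions_cons a i s :
  (alpha i \in inversions a (i :: s)) = (alpha i \notin inversions (rho i a) s).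
Proof. by rewrite inversions_cons ?alpha_proots // eqxx. Qed.

Lemma inversions_congr_cons a i s t :
  inversions (rho i a) s = inversions (rho i a) t ->
  inversions a (i :: s) = inversions a (i :: t).
Proof.
move=> st; apply/fsetP => x; have [xP|xP] := boolP (x \in proots a).
  by rewrite [LHS]inversions_cons ?[RHS]inversions_cons // st.
by rewrite !in_inversions (negPf xP).
Qed.

Lemma winv_consK a i s : winv a (i :: i :: s) = winv a s.
Proof. exact: word_equiv_winv (word_equiv_consK _ _ _). Qed.

Lemma inversions_consK a i s : inversions a (i :: i :: s) = inversions a s.
Proof. by apply/fsetP => x; rewrite !in_inversions winv_consK. Qed.

Lemma word_equiv_inversions a s t : word_equiv a s t -> inversions a s = inversions a t.
Proof. by move=> /word_equiv_winv st; apply/fsetP => x; rewrite !in_inversions st. Qed.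

(** The new set consists of [alpha i] and the reflected image of the old one. *)
Lemma card_inversions_cons a i s : alpha i \notin inversions (rho i a) s ->
  #|` inversions a (i :: s)| = #|` inversions (rho i a) s|.+1.
Proof.
move=> iN; set s' := sigma C i (rho i a).
have s'_inj : injective s' by move=> x y /(congr1 (sigma C i a)); rewrite !sigmaVK.
have -> : inversions a (i :: s) =
    alpha i |` [fset s' x | x in inversions (rho i a) s]%fset.
  apply/fsetP => x; rewrite in_fset1U; apply/idP/orP => [xN|].
    have xP := inversions_proots xN; move: xN; rewrite inversions_cons //.
    have [_|xi sx] := eqVneq x (alpha i); [by left|right].
    by apply/imfsetP; exists (sigma C i a x) => //; rewrite /s' sigmaK.
  case=> [/eqP->|]; first by rewrite alpha_inversions_cons.
  case/imfsetP => y /= yN ->; have yP := inversions_proots yN.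
  have yi : y != alpha i by apply: contraNneq iN => <-.
  have syP : s' y \in proots a by rewrite -[a](rho_invol C i) sigma_proots.
  rewrite inversions_cons // (negPf (sigma_proots_neq _ yP)).
  by rewrite /s' sigmaVK.
rewrite cardfsU1 card_imfset //; case: imfsetP => // -[y /= /inversions_proots yP /eqP].
by rewrite eq_sym (negPf (sigma_proots_neq _ yP)).
Qed.

(** The preceding count applied to [i :: s], where a second [i] cancels the first. *)
Lemma card_inversions_consN a i s : alpha i \in inversions (rho i a) s ->
  #|` inversions a (i :: s)|.+1 = #|` inversions (rho i a) s|.
Proof.
move=> iN; have := @card_inversions_cons (rho i a) i (i :: s).
by rewrite rho_invol inversions_consK => <- //; rewrite alpha_inversions_cons iN.
Qed.

(** * Reduced words and inversion sets of products *)

Lemma card_inversions_size a s : (#|` inversions a s| <= size s)%N.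
Proof.
elim: s a => [|i s IHs] a; first by rewrite inversions_nil cardfs0.
have := IHs (rho i a); have [iN|iN] := boolP (alpha i \in inversions (rho i a) s).
  by rewrite -(card_inversions_consN iN) => /ltnW/leqW.
by rewrite (card_inversions_cons iN).
Qed.

(** Reducedness by counting inversions; [length_word] relates the count to [length]. *)
Definition reduced a s := #|` inversions a s| == size s.

Lemma reducedP {a s} : reflect (#|` inversions a s| = size s) (reduced a s).
Proof. exact: eqP. Qed.

Lemma reduced_cons a i s :
  reduced a (i :: s) = (alpha i \notin inversions (rho i a) s) && reduced (rho i a) s.
Proof.
rewrite /reduced /=; have [iN|iN] := boolP (alpha i \in inversions (rho i a) s).
  have := card_inversions_size (rho i a) s.
  by rewrite -(card_inversions_consN iN) => sN; rewrite ltn_eqF // ltnS ltnW.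
by rewrite (card_inversions_cons iN) eqSS.
Qed.

(** The inverse map sends each simple root in the support of [x] to a negative root, hence also
    their nonnegative combination [x]. *)
Lemma inversions_cone a s x : x \in proots a ->
  (forall k, x k != 0 -> alpha k \in inversions a s) -> x \in inversions a s.
Proof.
move=> xP xk; have [rx xp] := prootsP _ _ xP; rewrite in_inversions xP /=.
rewrite -(root_nonnegN (root_winv s rx)) -opp_lfunE.
apply: lfun_nonneg => // k /xk; rewrite in_inversions => /andP[_].
by rewrite opp_lfunE (root_nonnegN (root_winv s (root_alpha a k))).
Qed.

Lemma inversions_coneN a s x : x \in proots a ->
  (forall k, x k != 0 -> alpha k \notin inversions a s) -> x \notin inversions a s.
Proof.
move=> xP xk; have [rx xp] := prootsP _ _ xP; rewrite in_inversions xP /= negbK.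
apply: lfun_nonneg => // k /xk; rewrite in_inversions alpha_proots.
by rewrite negbK.
Qed.

Lemma inversions_eq0 a s :
  (forall k, alpha k \notin inversions a s) -> inversions a s = fset0.
Proof.
move=> kN; apply/fsetP => x; rewrite in_fset0; apply/negP => xN.
by move/negP: (inversions_coneN (inversions_proots xN) (fun k _ => kN k)).
Qed.

Lemma inversions_full a s :
  (forall k, alpha k \in inversions a s) -> inversions a s = proots a.
Proof.
move=> kN; apply/fsetP => x; apply/idP/idP => [/inversions_proots //|xP].
exact: inversions_cone xP (fun k _ => kN k).
Qed.

(** Simple inversions are stripped one at a time until none is left. Only inversion sets are
    compared here; equality of the morphisms follows later, from [inversions_inj]. *)
Lemma exists_reduced a s : exists2 r, reduced a r & inversions a r = inversions a s.
Proof.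
have [n] := ubnP #|` inversions a s|; elim: n a s => // n IHn a s le_n.
have [/existsP[i iN]|/existsPn kN] := boolP [exists i, alpha i \in inversions a s].
  have iN' : alpha i \notin inversions (rho i a) (i :: s).
    by rewrite alpha_inversions_cons rho_invol iN.
  have c := card_inversions_cons iN'; rewrite inversions_consK in c.
  have [|r rr rN] := IHn (rho i a) (i :: s); first by lia.
  have rE : inversions a (i :: r) = inversions a s.
    by rewrite (inversions_congr_cons rN) inversions_consK.
  by exists (i :: r) => //; rewrite reduced_cons rr rN iN'.
by exists [::]; rewrite /reduced inversions_nil ?cardfs0 // (inversions_eq0 kN).
Qed.

Lemma in_inversions_cat a s t x :
  inversions a s `<=` inversions a (s ++ t) ->
  (x \in inversions a (s ++ t)) =
  (x \in inversions a s) || (x \in proots a) && (winv a s x \in inversions (src a s) t).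
Proof.
move=> sub; have [xN|xN] /= := boolP (x \in inversions a s); first exact: (fsubsetP sub).
move: xN; rewrite !in_inversions; case: (boolP (x \in proots a)) => //= xP.
rewrite negbK winv_cat => sx; have [rx _] := prootsP _ _ xP.
suff -> : winv a s x \in proots (src a s) by [].
by apply/prootsP; split=> //; apply: root_winv.
Qed.

(** If [x] were inverted by [s] but not by [s ++ t], then $-s^{-1}x$ would be an inversion of [t]
    that [s] sends to the negative root $-x$. *)
Lemma inversions_sub_cat a s t :
  (forall y, y \in inversions (src a s) t -> nonneg (wmap a s y)) ->
  inversions a s `<=` inversions a (s ++ t).
Proof.
move=> st; apply/fsubsetP => x; rewrite !in_inversions => /andP[xP sx].
have [rx xp] := prootsP _ _ xP; rewrite xP winv_cat /=; apply/negP => tsx.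
suff /st : - winv a s x \in inversions (src a s) t.
  by rewrite linearN /= winvK (root_nonnegN rx) xp.
rewrite in_inversions proots_opp //; last exact: root_winv.
by rewrite linearN /= (root_nonnegN (root_winv _ (root_winv _ rx))) negbK.
Qed.

Lemma reduced_cat_sub a s t : reduced a (s ++ t) ->
  inversions a s `<=` inversions a (s ++ t).
Proof.
elim: s a => [|i s IHs] a; first by rewrite inversions_nil fsub0set.
rewrite /= reduced_cons => /andP[iN /IHs /fsubsetP sub].
apply/fsubsetP => x xN; have xP := inversions_proots xN; move: xN.
rewrite (inversions_cons i s xP) (inversions_cons i (s ++ t) xP).
by case: eqP => // _; apply: sub.
Qed.

(** Induction on [s]: its first letter is a simple inversion of [t], so cancelling it removes
    exactly one inversion, and the inclusion persists for the remaining words. *)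
Lemma card_inversions_quotient a s t : reduced a s ->
  inversions a s `<=` inversions a t ->
  (#|` inversions (src a s) (rev s ++ t)| + size s)%N = #|` inversions a t|.
Proof.
elim: s a t => [|i s IHs] a t /=; first by rewrite addn0.
rewrite reduced_cons => /andP[iN rs] /fsubsetP sub.
have iNt : alpha i \in inversions a t by apply: sub; rewrite alpha_inversions_cons.
rewrite rev_cons cat_rcons addnS (IHs (rho i a) (i :: t)).
  have := @card_inversions_consN (rho i a) i t; rewrite rho_invol; exact.
by [].
apply/fsubsetP => x xN; have xP := inversions_proots xN.
have xi : x != alpha i by apply: contraNneq iN => <-.
rewrite inversions_cons // (negPf xi) rho_invol.
have sxP := sigma_proots xP xi; rewrite rho_invol in sxP.
apply: sub; rewrite inversions_cons // (negPf (sigma_proots_neq _ xP)).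
by rewrite sigmaVK.
Qed.

(** * Rank two *)

(** Membership in the plane of [alpha i] and [alpha j], by coordinates; [off2E] recovers the
    coefficients. *)
Definition off2 i j x := forall k, k != i -> k != j -> (x k : int) = 0.

Lemma off2C i j x : off2 i j x <-> off2 j i x.
Proof. by split=> xij k ki kj; apply: xij. Qed.

Lemma off2_alphal i j : off2 i j (alpha i).
Proof. by move=> k /negPf ki _; rewrite alphaE ki. Qed.

Lemma off2_alphar i j : off2 i j (alpha j).
Proof. by move=> k _ /negPf kj; rewrite alphaE kj. Qed.

Lemma off2E i j x : i != j -> off2 i j x ->
  x = (x i : int) *: alpha i + (x j : int) *: alpha j.
Proof.
move=> ij xij; rewrite {1}(vec_sum x) (bigD1 i) //= (bigD1 j) 1?eq_sym //= big1 ?addr0 //.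
by move=> k /andP[ki kj]; rewrite xij // scale0r.
Qed.

Lemma wmap_coord a i j s x k : all (pred2 i j) s -> k != i -> k != j ->
  (wmap a s x k : int) = x k.
Proof.
move=> + ki kj; elim: s a => [|l s IHs] a /=; first by rewrite id_lfunE.
move=> /andP[lij sij]; rewrite comp_lfunE sigma_coord ?IHs //.
by case/orP: lij => /eqP->.
Qed.

Lemma winv_coord a i j s x k : all (pred2 i j) s -> k != i -> k != j ->
  (winv a s x k : int) = x k.
Proof. by move=> sij ki kj; rewrite -[in RHS](winvK a s x) (wmap_coord _ _ sij). Qed.

Lemma sigma_coord_self a i j x : i != j -> off2 i j x ->
  (sigma C i a x i : int) = - x i - cmat C a i j * x j.
Proof.
move=> ij xij; rewrite {1}(off2E ij xij) linearD !linearZ /= sigma_alphai sigma_alpha.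
rewrite !ffunE eqxx (negPf ij) /GRing.scale /=; ring.
Qed.

(** The determinant on the plane of [alpha i] and [alpha j]: each letter contributes a reflection,
    of determinant $-1$. *)
Lemma wmap_det a i j s : i != j -> all (pred2 i j) s ->
  (wmap a s (alpha i) i : int) * wmap a s (alpha j) j
    - (wmap a s (alpha i) j : int) * wmap a s (alpha j) i = (-1) ^+ size s.
Proof.
move=> ij; have ji : j != i by rewrite eq_sym.
elim: s a => [|l s IHs] a /=.
  by rewrite !id_lfunE !alphaE !eqxx (negPf ij) (negPf ji) mulr0 subr0 mulr1.
move=> /andP[lij sij]; rewrite !comp_lfunE exprS -(IHs (rho l a) sij).
set v := wmap _ s (alpha i); set w := wmap _ s (alpha j).
have vij : off2 i j v.
  by move=> k ki kj; rewrite /v (wmap_coord _ _ sij) // alphaE (negPf ki).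
have wij : off2 i j w.
  by move=> k ki kj; rewrite /w (wmap_coord _ _ sij) // alphaE (negPf kj).
case/orP: lij => /eqP->.
  rewrite [sigma _ _ _ v j]sigma_coord // [sigma _ _ _ w j]sigma_coord //.
  by rewrite (sigma_coord_self _ ij vij) (sigma_coord_self _ ij wij); ring.
rewrite [sigma _ _ _ v i]sigma_coord // [sigma _ _ _ w i]sigma_coord //.
move: vij wij => /off2C vji /off2C wji.
by rewrite (sigma_coord_self _ ji vji) (sigma_coord_self _ ji wji); ring.
Qed.

(* In the span of alpha_i and alpha_j such a map is a nonnegative 2x2 matrix of
   determinant 1 whose inverse is nonnegative, hence the identity. *)
Lemma rank2_wmap_id a i j s : i != j -> all (pred2 i j) s -> ~~ odd (size s) ->
  (forall k, nonneg (wmap a s (alpha k))) ->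
  (forall k, nonneg (winv a s (alpha k))) -> wmap a s = \1%VF.
Proof.
move=> ij sij s2 wp vp; have ji : j != i by rewrite eq_sym.
have := wmap_det a ij sij; rewrite -signr_odd (negPf s2) expr0.
have hE l : off2 i j (alpha l) -> wmap a s (alpha l) =
    (wmap a s (alpha l) i : int) *: alpha i + (wmap a s (alpha l) j : int) *: alpha j.
  by move=> lij; apply: off2E => // k ki kj; rewrite (wmap_coord _ _ sij) // lij.
have := hE _ (@off2_alphal i j); have := hE _ (@off2_alphar i j).
have := wp i; have := wp j.
set x : int := wmap _ _ (alpha i) i; set y : int := wmap _ _ (alpha i) j.
set z : int := wmap _ _ (alpha j) i; set w : int := wmap _ _ (alpha j) j.
move=> /nonnegP wpj /nonnegP wpi hj hi det.
(* As the determinant is 1, the inverse matrix is the adjugate; its off-diagonal entries [- y] and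
   [- z] must be nonnegative, like [y] and [z]. *)
have gi : winv a s (alpha i) = w *: alpha i - y *: alpha j.
  rewrite -[RHS](wmapK a s) linearB !linearZ /= hi hj; congr (winv _ _ _).
  apply/ffunP => k; rewrite !ffunE /GRing.scale /=.
  transitivity ((x * w - y * z) * (k == i)%:R); last by ring.
  by rewrite det mul1r.
have gj : winv a s (alpha j) = x *: alpha j - z *: alpha i.
  rewrite -[RHS](wmapK a s) linearB !linearZ /= hi hj; congr (winv _ _ _).
  apply/ffunP => k; rewrite !ffunE /GRing.scale /=.
  transitivity ((x * w - y * z) * (k == j)%:R); last by ring.
  by rewrite det mul1r.
have y0 : y = 0.
  have /nonnegP/(_ j) := vp i; rewrite gi !ffunE eqxx (negPf ji) /GRing.scale /=.
  by have := wpi j; rewrite -/y; lia.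
have z0 : z = 0.
  have /nonnegP/(_ i) := vp j; rewrite gj !ffunE eqxx (negPf ij) /GRing.scale /=.
  by have := wpj i; rewrite -/z; lia.
have [x1 w1] : x = 1 /\ w = 1.
  move: (wpi i) (wpj j) det; rewrite -/x -/w y0 z0 mulr0 subr0 => xp wp1 xw.
  have /intUnitRing.unitzPl := xw; rewrite unfold_in => /orP[] /eqP wE.
    by move: xw; rewrite wE mulr1.
  by move: wp1; rewrite wE.
rewrite {}x1 {}y0 scale1r scale0r addr0 in hi; rewrite {}z0 {}w1 scale1r scale0r add0r in hj.
apply: lfun_alpha_eq => k; rewrite id_lfunE.
have [->//|ki] := eqVneq k i; have [->//|kj] := eqVneq k j.
(* Outside the plane, [alpha k] is shifted by a vector of the plane, and the inverse map shifts it
   by the opposite vector; nonnegativity of both images kills the shift. *)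
set u := wmap a s (alpha k); have uij : off2 i j (u - alpha k).
  by move=> l li lj; rewrite !ffunE (wmap_coord _ _ sij) // alphaE subrr.
have uE := off2E ij uij; set e : int := (u - alpha k) i in uE.
set f : int := (u - alpha k) j in uE.
have gk : winv a s (alpha k) = alpha k - (e *: alpha i + f *: alpha j).
  rewrite -[RHS](wmapK a s); congr (winv _ _ _).
  by rewrite linearB linearD !linearZ /= hi hj -uE opprB addrCA subrr addr0.
have /nonnegP up := wp k; have /nonnegP := vp k; rewrite gk => gp.
have eE : e = u i.
  by rewrite /e !ffunE [i == k]eq_sym (negPf ki) subr0.
have fE : f = u j.
  by rewrite /f !ffunE [j == k]eq_sym (negPf kj) subr0.
have e0 : e = 0.
  have := up i; have := gp i; rewrite -/u -eE !ffunE eqxx (negPf ij).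
  by rewrite [i == k]eq_sym (negPf ki) /GRing.scale /=; lia.
have f0 : f = 0.
  have := up j; have := gp j; rewrite -/u -fE !ffunE eqxx (negPf ji).
  by rewrite [j == k]eq_sym (negPf kj) /GRing.scale /=; lia.
by apply/eqP; rewrite -subr_eq0 uE e0 f0 !scale0r addr0.
Qed.


(** * Alternating words, the braid relation and reduced words *)

Lemma inversions_congr_cat a p s t :
  inversions (src a p) s = inversions (src a p) t ->
  inversions a (p ++ s) = inversions a (p ++ t).
Proof. by elim: p a => //= i p IHp a st; apply/inversions_congr_cons/IHp. Qed.

Lemma word_equiv_catK a p s : word_equiv a (p ++ rev p ++ s) s.
Proof.
split; first by rewrite !word_src_cat src_rev.
by apply/lfunP => x; rewrite !wmap_cat src_rev wmap_rev winvK.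
Qed.

Fixpoint alt i j n : seq I := if n is n'.+1 then i :: alt j i n' else [::].

Lemma size_alt i j n : size (alt i j n) = n.
Proof. by elim: n i j => //= n IHn i j; rewrite IHn. Qed.

Lemma all_alt i j n : all (pred2 i j) (alt i j n).
Proof.
elim: n i j => //= n IHn i j; rewrite eqxx /= -(eq_all (a1 := pred2 j i)) //.
by move=> k /=; rewrite orbC.
Qed.

(** For distinct [i] and [j], the roots in [rank2_cone i j]; the cardinal is the exponent
    $m^a_{i,j}$ of (R4). *)
Definition proots2 a i j : {fset ZI I} :=
  [fset x in proots a | [forall k, (k != i) && (k != j) ==> (x k == 0)]].

Lemma proots2P a i j x : reflect (x \in proots a /\ off2 i j x) (x \in proots2 a i j).
Proof.
rewrite !inE; apply: (iffP andP) => [[xP /forallP xk]|[xP xk]].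
  split=> // k ki kj; apply/eqP; exact: (implyP (xk k)) (introT andP (conj ki kj)).
by split=> //; apply/forallP => k; apply/implyP => /andP[ki kj]; rewrite xk.
Qed.

Lemma proots2C a i j : proots2 a i j = proots2 a j i.
Proof.
by apply/fsetP => x; apply/proots2P/proots2P => -[xP /off2C].
Qed.

Lemma alpha_proots2 a i j : alpha i \in proots2 a i j.
Proof. by apply/proots2P; split; [apply: alpha_proots|apply: off2_alphal]. Qed.

(** The reflection injects the elements other than [alpha i] in either direction. *)
Lemma card_proots2_rho a i j : #|` proots2 (rho i a) i j| = #|` proots2 a i j|.
Proof.
suff le b : (#|` proots2 b i j| <= #|` proots2 (rho i b) i j|)%N.
  by apply/eqP; rewrite eqn_leq le -{2}[a](rho_invol C i) le.
rewrite (cardfsD1 (alpha i)) (cardfsD1 (alpha i) (proots2 (rho i b) i j)).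
rewrite !alpha_proots2 leq_add2l.
have s_inj : injective (sigma C i b).
  by move=> x y /(congr1 (sigma C i (rho i b))); rewrite !sigmaK.
have /= <- := card_imfset imfset_key (mem (proots2 b i j `\ alpha i)) s_inj.
apply/fsubset_leq_card/fsubsetP => _ /imfsetP[x /= + ->].
rewrite !in_fsetD1 => /andP[xi /proots2P[xP xij]].
rewrite (sigma_proots_neq _ xP); apply/proots2P; split; first exact: sigma_proots.
by move=> k ki kj; rewrite sigma_coord // xij.
Qed.

Lemma proots2_inversions a i j s :
  alpha i \in inversions a s -> alpha j \in inversions a s ->
  proots2 a i j `<=` inversions a s.
Proof.
move=> iN jN; apply/fsubsetP => x /proots2P[xP xij].
apply: inversions_cone xP _ => k; have [->//|ki] := eqVneq k i.
by have [->//|kj] := eqVneq k j; rewrite xij.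
Qed.

(** If prepending [i] failed to be reduced, the shorter word would invert both [alpha i] and
    [alpha j], hence all of [proots2], which has more elements than the word has letters. *)
Lemma reduced_alt a i j n : (n <= #|` proots2 a i j|)%N -> reduced a (alt i j n).
Proof.
elim: n a i j => [|n IHn] a i j nP; first by apply/reducedP; rewrite inversions_nil cardfs0.
have nP' : (n < #|` proots2 (rho i a) i j|)%N by rewrite card_proots2_rho.
have rn : reduced (rho i a) (alt j i n) by apply: IHn; rewrite proots2C ltnW.
rewrite /= reduced_cons rn andbT; apply/negP => iN.
case: n {IHn nP} => [|n] in nP' rn iN *; first by rewrite inversions_nil in_fset0 in iN.
have jN : alpha j \in inversions (rho i a) (alt j i n.+1).
  have /= := rn; rewrite reduced_cons => /andP[jN _].
  rewrite /= alpha_inversions_cons; exact: jN.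
have := fsubset_leq_card (proots2_inversions iN jN).
by rewrite (reducedP rn) size_alt leqNgt nP'.
Qed.

(** Letters [i] and [j] leave the other coordinates unchanged, so an inverted root has none of them
    nonzero; equality follows by counting. *)
Lemma inversions_alt a i j :
  inversions a (alt i j #|` proots2 a i j|) = proots2 a i j.
Proof.
apply/eqP; rewrite eqEfcard; set m := #|` proots2 a i j|.
rewrite (reducedP (reduced_alt (leqnn m))) size_alt leqnn andbT.
apply/fsubsetP => x; rewrite in_inversions => /andP[xP].
have [rx /nonnegP xp] := prootsP _ _ xP.
rewrite -(root_nonnegN (root_winv _ rx)) => /nonnegP wx.
apply/proots2P; split=> // k ki kj; apply/le_anti; rewrite xp andbT.
by have := wx k; rewrite ffunE (winv_coord _ _ (all_alt i j m)) // oppr_ge0.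
Qed.

(** The iterate applies [2 * n] involutions; the letters of [alt j i n] undo the last [n], leaving
    those of [alt i j n]. *)
Lemma src_alt_iter a i j n :
  src (iter n (rho j \o rho i) a) (alt j i n) = src a (alt i j n).
Proof.
elim: n a i j => //= n IHn a i j; rewrite rho_invol -[RHS]IHn; congr (src _ _).
by elim: n {IHn} => //= n ->.
Qed.

Lemma src_alt a i j : i != j ->
  src a (alt i j #|` proots2 a i j|) = src a (alt j i #|` proots2 a i j|).
Proof.
move=> ij; rewrite -src_alt_iter; congr (src _ _).
have [[_ _ _ R4] _] := hfin; apply: R4; first by rewrite eq_sym.
(* The exponent of (R4) counts roots in the cone, which are automatically positive. *)
suff -> : (root a `&` @rank2_cone I j i = [set` proots2 a i j])%classic.
  exact/card_eq_fsetP.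
rewrite predeqE => x; split=> [[rx [m [n xE]]]|/proots2P[/prootsP[rx /nonnegP xp] xij]].
  apply/proots2P; split; last first.
    by move=> k ki kj; rewrite xE !ffunE -?scaler_nat ?ffunE (negPf ki) (negPf kj) ?scaler0.
  apply/prootsP; split=> //; apply/nonnegP => k.
  by rewrite xE -!scaler_nat !ffunE /GRing.scale /= addr_ge0 // mulr_ge0 // natz.
split=> //; exists `|x j : int|%N, `|x i : int|%N.
rewrite {1}(off2E ij xij) addrC -!scaler_nat !natz !gez0_abs //.
Qed.

(** With equal inversion sets, the inverses of [s] and [t] give every root the same sign; this is
    applied to the root that [s] makes from [alpha k]. *)
Lemma inversions_eq_nonneg a s t k :
  src a s = src a t -> inversions a s = inversions a t ->
  nonneg (winv a t (wmap a s (alpha k))).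
Proof.
move=> sst st; set x := wmap a s (alpha k).
have rx : root a x by apply: root_wmap; apply: root_alpha.
have [xp|xn] := boolP (nonneg x).
  have : x \notin inversions a s.
    by rewrite in_inversions wmapK nonneg_alpha andbF.
  rewrite st in_inversions negb_and negbK => /orP[/prootsP[]|//]; by split.
have xP : - x \in proots a by apply: proots_opp.
have : - x \in inversions a s.
  by rewrite in_inversions xP linearN /= wmapK (root_nonnegN (root_alpha a k)) nonneg_alpha.
by rewrite st in_inversions linearN /= (root_nonnegN (root_winv t rx)) negbK => /andP[].
Qed.

Lemma braid a i j : i != j ->
  word_equiv a (alt i j #|` proots2 a i j|) (alt j i #|` proots2 a i j|).
Proof.
move=> ij; set m := #|` proots2 a i j|; have sE := src_alt a ij; rewrite -/m in sE.
set p := alt i j m in sE *; set q := alt j i m in sE *; split=> //.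
have pq : inversions a p = inversions a q.
  by rewrite /p /q [in RHS]/m proots2C !inversions_alt proots2C.
(* The quotient $q^{-1}p$ has an even number of letters, and it and its inverse keep simple roots
   nonnegative. *)
have uE : wmap (src a q) (rev q ++ p) = \1%VF.
  apply: (rank2_wmap_id (i := i) (j := j)) => //.
  - rewrite all_cat all_rev all_alt andbT -(eq_all (a1 := pred2 j i)) ?all_alt //.
    by move=> k /=; rewrite orbC.
  - by rewrite size_cat size_rev !size_alt addnn odd_double.
  - move=> k; rewrite wmap_cat src_rev wmap_rev; exact: inversions_eq_nonneg.
  - by move=> k; rewrite winv_catl; apply: inversions_eq_nonneg.
apply/lfunP => x; have := congr1 (fun f : 'End(ZI I) => wmap a q (f x)) uE.
by rewrite /= wmap_cat src_rev wmap_rev winvK id_lfunE.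
Qed.

(* Two reduced words with the same inversions and different first letters i and j
   both have the longest element of the rank two parabolic {i, j} as a prefix. *)
Lemma reduced_word_equiv a s t : reduced a s -> reduced a t ->
  inversions a s = inversions a t -> word_equiv a s t.
Proof.
have [n] := ubnP (size s); elim: n a s t => // n IHn a s t le_n rs rt st.
have IHcons i s' t' b : (size s' < n)%N -> reduced b (i :: s') -> reduced b (i :: t') ->
    inversions b (i :: s') = inversions b (i :: t') -> word_equiv b (i :: s') (i :: t').
  move=> lt_n; rewrite !reduced_cons => /andP[_ rs'] /andP[_ rt'] st'.
  apply/word_equiv_cons/IHn => //.
  rewrite -(inversions_consK _ i s') -(inversions_consK _ i t').
  by apply: inversions_congr_cons; rewrite rho_invol.
have sz : size s = size t by rewrite -(reducedP rs) st (reducedP rt).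
case: s t => [|i s] [|j t] in le_n rs rt st sz * => //; try by case: sz.
have [ij|ij] := eqVneq i j; first by subst j; apply: IHcons.
have iN : alpha i \in inversions a (i :: s).
  by move: rs; rewrite reduced_cons alpha_inversions_cons => /andP[].
have jN : alpha j \in inversions a (i :: s).
  by rewrite st; move: rt; rewrite reduced_cons alpha_inversions_cons => /andP[].
set m := #|` proots2 a i j|; have br := braid a ij; rewrite -/m in br.
set p := alt i j m in br *; set q := alt j i m in br *.
have pE : inversions a p = proots2 a i j by apply: inversions_alt.
have rp : reduced a p by apply: reduced_alt.
have psub : inversions a p `<=` inversions a (i :: s).
  by rewrite pE proots2_inversions.
(* Here [r] completes [p] to a reduced word [p ++ r] with the inversions of [i :: s]; by the braid
   relation [q ++ r] has them too. *)
have [r rr rE] := exists_reduced (src a p) (rev p ++ i :: s).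
have cr := card_inversions_quotient rp psub; rewrite -rE (reducedP rr) in cr.
have prE : inversions a (p ++ r) = inversions a (i :: s).
  rewrite -(word_equiv_inversions (word_equiv_catK a p (i :: s))).
  exact: inversions_congr_cat.
have rpr : reduced a (p ++ r) by apply/reducedP; rewrite prE -cr size_cat addnC.
have qrE : inversions a (q ++ r) = inversions a (i :: s).
  by rewrite -prE; apply/word_equiv_inversions/word_equiv_catr/word_equiv_sym.
have rqr : reduced a (q ++ r) by apply/reducedP; rewrite qrE -cr size_cat addnC !size_alt.
have m0 : (0 < m)%N.
  by rewrite /m (cardfsD1 (alpha i)) alpha_proots2.
(* Since [m] is positive, [p] begins with [i] and [q] with [j], so each comparison is between words
   with a common first letter. *)
case E : m m0 => [//|m'] _.
have ti : word_equiv a (i :: s) (p ++ r).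
  rewrite /p E /= in rpr prE *; apply: IHcons => //.
have tj : word_equiv a (j :: t) (q ++ r).
  rewrite /q E /= in rqr qrE *; apply: IHcons => //.
    by case: sz => <-.
  by rewrite qrE.
apply: word_equiv_trans ti (word_equiv_trans _ (word_equiv_sym tj)).
exact: word_equiv_catr.
Qed.

(** If [i :: r] is not reduced, take a reduced [r'] with its inversions. Then [i :: r'] is reduced
    with the inversions of [r], so it represents the same morphism, and [i] cancels. *)
Lemma exists_reduced_equiv a s : exists2 r, reduced a r & word_equiv a s r.
Proof.
elim: s a => [|i s IHs] a.
  by exists [::]; [apply/reducedP; rewrite inversions_nil cardfs0|apply: word_equiv_refl].
have [r rr sr] := IHs (rho i a); have [iN|iN] := boolP (alpha i \in inversions (rho i a) r).
  have [r' rr' rE] := exists_reduced a (i :: r); exists r' => //.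
  have rr2 : reduced (rho i a) (i :: r').
    by rewrite reduced_cons rho_invol rr' rE alpha_inversions_cons iN.
  have rE2 : inversions (rho i a) (i :: r') = inversions (rho i a) r.
    by rewrite -(inversions_consK _ i r); apply: inversions_congr_cons; rewrite rho_invol.
  have rr'2 := reduced_word_equiv rr rr2 (esym rE2).
  apply: word_equiv_trans (word_equiv_consK a i r').
  exact/word_equiv_cons/(word_equiv_trans sr).
by exists (i :: r); [rewrite reduced_cons iN|apply: word_equiv_cons].
Qed.

(** * Morphisms from inversion sets; complements and full inversion sets *)

Lemma inversions_inj a s t : inversions a s = inversions a t -> word_equiv a s t.
Proof.
move=> st; have [r rr sr] := exists_reduced_equiv a s.
have [r' rr' tr'] := exists_reduced_equiv a t.
have rr'E : word_equiv a r r'.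
  apply: reduced_word_equiv => //.
  by rewrite -(word_equiv_inversions sr) st (word_equiv_inversions tr').
exact: word_equiv_trans sr (word_equiv_trans rr'E (word_equiv_sym tr')).
Qed.

(** The inverse of [t] reverses the sign of every root. *)
Lemma inversions_compl a s t : inversions (src a s) t = proots (src a s) ->
  inversions a (s ++ t) = proots a `\` inversions a s.
Proof.
move=> tN; apply/fsetP => x; rewrite in_fsetD !in_inversions.
have [xP /=|_] := boolP (x \in proots a); last by rewrite andbF.
have [rx _] := prootsP _ _ xP; have rs := root_winv s rx.
rewrite winv_cat andbT negbK.
have [sp|sn] := boolP (nonneg (winv a s x)).
  have : winv a s x \in inversions (src a s) t by rewrite tN; apply/prootsP.
  by rewrite in_inversions => /andP[].
have : - winv a s x \in inversions (src a s) t by rewrite tN proots_opp.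
by rewrite in_inversions linearN /= (root_nonnegN (root_winv t rs)) negbK => /andP[_ ->].
Qed.

Lemma inversions_full_rev a s : inversions a s = proots a ->
  inversions (src a s) (rev s) = proots (src a s).
Proof.
move=> sN; apply/fsetP => x; rewrite in_inversions winv_rev andb_idr // => /prootsP[rx xp].
apply/negP => sx; have : wmap a s x \in inversions a s.
  by rewrite sN; apply/prootsP; split=> //; apply: root_wmap.
by rewrite in_inversions wmapK xp andbF.
Qed.

(** While some [alpha i] is not inverted, prepending [i] adds an inversion. This moves the target
    and keeps the source, so words with source [a] are grown, then reversed. *)
Lemma exists_full a : exists s, inversions a s = proots a.
Proof.
(* The bound runs over all objects because the target varies. *)
pose M := \max_(c : A) #|` proots c|.
suff [c [s [sc [sN|sN]]]] : exists c s, src c s = a /\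
    (inversions c s = proots c \/ (M < #|` inversions c s|)%N).
- by exists (rev s); rewrite -sc inversions_full_rev.
- have : (#|` inversions c s| <= M)%N.
    apply: leq_trans (leq_bigmax c); apply/fsubset_leq_card/fsubsetP => x.
    exact: inversions_proots.
  by rewrite leqNgt sN.
elim: M.+1 => [|n [c [s [sc [sN|sN]]]]]; first by exists a, [::]; split=> //; right.
  by exists c, s; split=> //; left.
have [/forallP kN|/forallPn[i iN]] := boolP [forall k, alpha k \in inversions c s].
  by exists c, s; split=> //; left; apply: inversions_full.
exists (rho i c), (i :: s); rewrite /= rho_invol; split=> //; right.
by rewrite card_inversions_cons ?rho_invol // ltnS.
Qed.

(** * Joins *)

(** If [z] sends [y] to a negative root, its opposite is an inversion of [z], hence of [w], so the
    quotient $z^{-1}w$ keeps [y] positive. *)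
Lemma in_inversions_quotient a z w y : inversions a z `<=` inversions a w ->
  y \in proots (src a z) ->
  (y \in inversions (src a z) (rev z ++ w)) = (wmap a z y \in inversions a w).
Proof.
move=> /fsubsetP zw yP; have [ry yp] := prootsP _ _ yP.
rewrite !in_inversions yP winv_catl /=.
have rz := root_wmap ry.
have [zp|zn] := boolP (nonneg (wmap a z y)).
  by have -> : wmap a z y \in proots a by apply/prootsP.
have /negPf-> /= : wmap a z y \notin proots a by apply: contra zn => /prootsP[].
apply/negbTE; rewrite negbK.
have : - wmap a z y \in inversions a z.
  by rewrite in_inversions proots_opp //= linearN /= wmapK (root_nonnegN ry) yp.
move/zw; rewrite in_inversions linearN /= (root_nonnegN (root_winv w rz)) negbK.
by case/andP.
Qed.

(** Left multiplication by [z] carries what lies below $z^{-1}x$ into the interval from [z] to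
    [x]. *)
Lemma inversions_cat_le a z p (x : seq I) : inversions a z `<=` inversions a x ->
  inversions (src a z) p `<=` inversions (src a z) (rev z ++ x) ->
  inversions a z `<=` inversions a (z ++ p) /\ inversions a (z ++ p) `<=` inversions a x.
Proof.
move=> zx /fsubsetP px.
have wp y : y \in inversions (src a z) p -> wmap a z y \in inversions a x.
  by move=> yp; rewrite -in_inversions_quotient ?px // (inversions_proots yp).
have zp : inversions a z `<=` inversions a (z ++ p).
  apply: inversions_sub_cat => y /wp /inversions_proots yP.
  by have [] := prootsP _ _ yP.
split=> //; apply/fsubsetP => y; rewrite in_inversions_cat // => /orP[|/andP[_ /wp]].
  exact: (fsubsetP zx).
by rewrite winvK.
Qed.

(** Otherwise $z^{-1}x$ inverts no simple root, hence no root, and [z] and [x] have equal inversion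
    sets. *)
Lemma exists_cover a z (x : seq I) : inversions a z `<=` inversions a x ->
  inversions a z != inversions a x ->
  exists i, alpha i \in inversions (src a z) (rev z ++ x).
Proof.
move=> zx nzx; apply/existsP; apply: contraNT nzx => /existsPn kN; apply/eqP.
rewrite -(word_equiv_inversions (word_equiv_catK a z x)) -[in LHS](cats0 z).
apply: inversions_congr_cat; rewrite inversions_nil.
by rewrite inversions_eq0.
Qed.

Lemma inversions_singleton a i x : (x \in inversions a [:: i]) = (x == alpha i).
Proof.
have [xP|xP] := boolP (x \in proots a).
  by rewrite inversions_cons // inversions_nil !in_fset0; case: eqP.
rewrite in_inversions (negPf xP); apply/esym/negbTE; apply: contraNneq xP => ->.
exact: alpha_proots.
Qed.

Lemma inversions_rcons a z i (x : seq I) : inversions a z `<=` inversions a x ->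
  alpha i \in inversions (src a z) (rev z ++ x) ->
  [/\ inversions a z `<=` inversions a (z ++ [:: i]),
      inversions a (z ++ [:: i]) `<=` inversions a x
    & (#|` inversions a z| < #|` inversions a (z ++ [:: i])|)%N].
Proof.
move=> zx iN; have [|zi ix] := @inversions_cat_le a z [:: i] x zx.
  by apply/fsubsetP => y; rewrite inversions_singleton => /eqP->.
split=> //; suff : inversions a z `<` inversions a (z ++ [:: i]).
  by rewrite fproperEcard => /andP[].
rewrite fproperEneq zi andbT; apply/eqP => zE.
have : wmap a z (alpha i) \in inversions a (z ++ [:: i]).
  rewrite (in_inversions_cat _ zi) wmapK inversions_singleton eqxx.
  have := iN; rewrite in_inversions_quotient ?alpha_proots // => /inversions_proots->.
  by rewrite orbT.
by rewrite -zE in_inversions wmapK nonneg_alpha andbF.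
Qed.

(* The join of the covers z i and z j is z times the longest element of the rank
   two parabolic {i, j}. With x' = z i <= x and y' = z j <= y, the join of x and y is
   then obtained from joins above x' and above y'. *)
Lemma exists_join_above a z (x y : seq I) :
  inversions a z `<=` inversions a x -> inversions a z `<=` inversions a y ->
  exists v, [/\ inversions a x `<=` inversions a v, inversions a y `<=` inversions a v
    & forall e, inversions a x `<=` inversions a e -> inversions a y `<=` inversions a e ->
        inversions a v `<=` inversions a e].
Proof.
have le_P s : (#|` inversions a s| <= #|` proots a|)%N.
  by apply/fsubset_leq_card/fsubsetP => u; apply: inversions_proots.
(* Induction on the number of positive roots that [z] does not invert. *)
have [n] := ubnP (#|` proots a| - #|` inversions a z|)%N.
elim: n z x y => // n IHn z x y le_n zx zy.
have [zx'|/(exists_cover zx)[i iN]] := eqVneq (inversions a z) (inversions a x).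
  by exists y; split=> //; rewrite -zx'.
have [zy'|/(exists_cover zy)[j jN]] := eqVneq (inversions a z) (inversions a y).
  by exists x; split=> //; rewrite -zy'.
have [zi ix ci] := inversions_rcons zx iN.
have [zj jy cj] := inversions_rcons zy jN.
have IHc k : (#|` inversions a z| < #|` inversions a (z ++ [:: k])|)%N ->
    (#|` proots a| - #|` inversions a (z ++ [:: k])| < n)%N.
  by have := le_P (z ++ [:: k]); move: le_n; lia.
have [ij|ij] := eqVneq i j.
  by apply: (IHn (z ++ [:: i])) => //; [apply: IHc|rewrite ij].
set p := alt i j #|` proots2 (src a z) i j|.
have pE : inversions (src a z) p = proots2 (src a z) i j by apply: inversions_alt.
(* For any common upper bound [e], the quotient $z^{-1}e$ inverts [alpha i] and [alpha j], hence all
   inversions of [p]. *)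
have below e : inversions a x `<=` inversions a e -> inversions a y `<=` inversions a e ->
    inversions a z `<=` inversions a (z ++ p) /\ inversions a (z ++ p) `<=` inversions a e.
  move=> xe ye; have ze := fsubset_trans zx xe.
  apply: inversions_cat_le => //; rewrite pE; apply: proots2_inversions.
    rewrite in_inversions_quotient ?alpha_proots //; apply: (fsubsetP xe).
    by rewrite -in_inversions_quotient ?alpha_proots.
  rewrite in_inversions_quotient ?alpha_proots //; apply: (fsubsetP ye).
  by rewrite -in_inversions_quotient ?alpha_proots.
have [w0 w0N] := exists_full a.
have le_w0 s : inversions a s `<=` inversions a w0.
  by rewrite w0N; apply/fsubsetP => u; apply: inversions_proots.
have [zp _] := below w0 (le_w0 x) (le_w0 y).
have covp k : alpha k \in proots2 (src a z) i j ->
    inversions a (z ++ [:: k]) `<=` inversions a (z ++ p).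
  move=> kP; have kN : alpha k \in inversions (src a z) (rev z ++ z ++ p).
    by have := word_equiv_inversions (word_equiv_catK (src a z) (rev z) p);
      rewrite revK pE => ->.
  by have [] := inversions_rcons zp kN.
have ip : inversions a (z ++ [:: i]) `<=` inversions a (z ++ p).
  by apply: covp; apply: alpha_proots2.
(* First join [x] with [z ++ p] above the cover by [i]; the result lies above the cover by [j],
   where it is joined with [y]. *)
have [u [xu tu uE]] := IHn _ x (z ++ p) (IHc i ci) ix ip.
have jp : inversions a (z ++ [:: j]) `<=` inversions a (z ++ p).
  by apply: covp; rewrite proots2C alpha_proots2.
have [v [uv yv vE]] := IHn _ u y (IHc j cj) (fsubset_trans jp tu) jy.
exists v; split=> // [|e xe ye]; first exact: fsubset_trans xu uv.
by apply: vE => //; apply: uE => //; have [] := below e xe ye.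
Qed.

Lemma exists_join a (x y : seq I) :
  exists v, [/\ inversions a x `<=` inversions a v, inversions a y `<=` inversions a v
    & forall e, inversions a x `<=` inversions a e -> inversions a y `<=` inversions a e ->
        inversions a v `<=` inversions a e].
Proof. by apply: (@exists_join_above a [::]); rewrite inversions_nil fsub0set. Qed.

(** * Morphisms and the weak order *)

Fact word_hom_subproof a s : `[< exists t, word_eq C (src a s) a (wmap a s) t >].
Proof. by apply/asboolP; exists s; rewrite /word_eq !eqxx. Qed.

Definition word_hom a s : hom_to C a := mk_hom_to (Defs.Hom (word_hom_subproof a s)).

Lemma mk_hom_to_word b a (w : Defs.hom C b a) s :
  word_eq C b a w s -> mk_hom_to w = word_hom a s.
Proof.
case: w => f fP /= /andP[/eqP sb /eqP sf]; subst b f; rewrite /word_hom.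
by rewrite (Prop_irrelevance fP (word_hom_subproof a s)).
Qed.

Fact hom_word_subproof : {f : forall a, hom_to C a -> seq I |
  forall a (w : hom_to C a), word_eq C (tag w) a (tagged w) (f a w)}.
Proof.
by exists (fun a (w : hom_to C a) => xchoose (homP (tagged w))) => a w; apply: xchooseP.
Qed.

(* Sealed for the same reason as inversions. *)
Definition hom_word a (w : hom_to C a) : seq I := sval hom_word_subproof a w.

Lemma hom_wordP a (w : hom_to C a) : word_eq C (tag w) a (tagged w) (hom_word w).
Proof. exact: (svalP hom_word_subproof). Qed.

Lemma word_eq_equiv b a f s t : word_eq C b a f s -> word_eq C b a f t -> word_equiv a s t.
Proof. by move=> /andP[/eqP sb /eqP sf] /andP[/eqP tb /eqP tf]; split; congruence. Qed.

Lemma word_equiv_hom a s t : word_equiv a s t -> word_hom a s = word_hom a t.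
Proof.
case=> st st'; apply: mk_hom_to_word; apply/andP; split; apply/eqP; first exact: esym.
exact: esym st'.
Qed.

Definition hom_inversions a (w : hom_to C a) := inversions a (hom_word w).

Lemma word_homK a (w : hom_to C a) : word_hom a (hom_word w) = w.
Proof. by rewrite -(mk_hom_to_word (hom_wordP w)); case: w. Qed.

Lemma hom_inversions_word a s : hom_inversions (word_hom a s) = inversions a s.
Proof.
apply/word_equiv_inversions/(word_eq_equiv (hom_wordP _)).
by rewrite /word_eq /= !eqxx.
Qed.

Lemma hom_inversions_inj a : injective (@hom_inversions a).
Proof.
by move=> u v uv; rewrite -(word_homK u) -(word_homK v); apply/word_equiv_hom/inversions_inj.
Qed.

Lemma hom_inversions_proots a (w : hom_to C a) : hom_inversions w `<=` proots a.
Proof. by apply/fsubsetP => x; apply: inversions_proots. Qed.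

(** A reduced word attains the inversion count, and no word for [w] is shorter. *)
Lemma length_word b a (w : Defs.hom C b a) s :
  word_eq C b a w s -> length w = #|` inversions a s|.
Proof.
move=> ws; rewrite /length; case: ex_minnP => k /existsP[t wt] k_min.
apply/eqP; rewrite eqn_leq; apply/andP; split.
  have [r /reducedP rr sr] := exists_reduced_equiv a s.
  rewrite (word_equiv_inversions sr) rr; apply: k_min.
  apply/existsP; exists (in_tuple r) => /=.
  by move: ws; rewrite /word_eq; case: sr => -> ->.
rewrite (word_equiv_inversions (word_eq_equiv ws wt)) -[leqRHS](size_tuple t).
exact: card_inversions_size.
Qed.

Lemma word_eq_comp c b a (u : Defs.hom C b a) (v : Defs.hom C c b) s t :
  word_eq C b a u s -> word_eq C c b v t -> word_eq C c a (hom_comp u v) (s ++ t).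
Proof.
move=> /andP[/eqP sb /eqP su] /andP[/eqP tc /eqP tv].
by rewrite /word_eq word_src_cat word_map_cat sb tc su tv !eqxx.
Qed.

(** Additive lengths make the concatenation of reduced words reduced, so inversions of the prefix
    persist. Conversely $u^{-1}w$ is the required factor, its length given by
    [card_inversions_quotient]. *)
Lemma weak_leE a (u w : hom_to C a) :
  weak_le u w <-> hom_inversions u `<=` hom_inversions w.
Proof.
have [r ru ur] := exists_reduced_equiv a (hom_word u).
have uE : word_eq C (tag u) a (tagged u) r.
  by move: (hom_wordP u); rewrite /word_eq; case: ur => -> ->.
have uN : hom_inversions u = inversions a r by apply: word_equiv_inversions.
split=> [[c [v [-> len]]]|uw].
  have [s vs] := homP v; have [t rt st] := exists_reduced_equiv (tag u) s.
  have vt : word_eq C c (tag u) v t by move: vs; rewrite /word_eq; case: st => -> ->.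
  have uvE := word_eq_comp uE vt.
  rewrite (mk_hom_to_word uvE) hom_inversions_word uN; apply: reduced_cat_sub.
  apply/reducedP; rewrite size_cat -(reducedP ru) -(reducedP rt).
  by rewrite -(length_word uE) -(length_word vt) len (length_word uvE).
pose p := rev r ++ hom_word w; have /andP[/eqP su _] := uE.
have vp : word_eq C (src a (hom_word w)) (tag u) (wmap (tag u) p) p.
  by rewrite /word_eq /p word_src_cat -su src_rev !eqxx.
have vP : `[< exists s, word_eq C (src a (hom_word w)) (tag u) (wmap (tag u) p) s >].
  by apply/asboolP; exists p.
have uvE := word_eq_comp uE (vp : word_eq C _ _ (Defs.Hom vP) p).
have rpE := word_equiv_catK a r (hom_word w).
exists (src a (hom_word w)), (Defs.Hom vP); split.
  by rewrite (mk_hom_to_word uvE) (word_equiv_hom rpE) word_homK.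
rewrite (length_word uE) (length_word (w := Defs.Hom vP) vp) (length_word uvE).
rewrite (word_equiv_inversions rpE) /p -su (reducedP ru) addnC.
by apply: card_inversions_quotient => //; rewrite -uN.
Qed.

(** * The orthocomplement and the lattice structure *)

Lemma longest_inversions a : hom_inversions (longest C a) = proots a.
Proof.
have [w0 w0N] : exists w0 : hom_to C a, hom_inversions w0 = proots a.
  by have [s sN] := exists_full a; exists (word_hom a s); rewrite hom_inversions_word.
have le_w0 w : weak_le w w0 by rewrite weak_leE w0N hom_inversions_proots.
(* A chosen [w] is maximal and below [w0], hence equal to it; the default case is excluded because
   [w0] itself has the defining property. *)
rewrite /longest; case: xgetP => [w _ wP|/(_ w0)[] v].
  have wM : forall v : hom_to C a, weak_maximal v <-> v = w by exact: wP.
  by have <- := (wM w).2 erefl w0 (le_w0 w).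
split=> [/(_ _ (le_w0 v)) //|-> v' /weak_leE w0v'].
apply: hom_inversions_inj; apply/eqP.
by rewrite eqEfsubset w0v' w0N hom_inversions_proots.
Qed.

Lemma perp_inversions a (w : hom_to C a) :
  hom_inversions (perp w) = proots a `\` hom_inversions w.
Proof.
have wE := hom_wordP w; have /andP[/eqP sw _] := wE.
rewrite /perp (mk_hom_to_word (word_eq_comp wE (hom_wordP (longest C (tag w))))).
by rewrite hom_inversions_word inversions_compl // sw; apply: longest_inversions.
Qed.

Lemma perpK a : involutive (@perp I A C a).
Proof.
move=> w; apply: hom_inversions_inj; rewrite !perp_inversions fsetDK //.
exact: hom_inversions_proots.
Qed.

Lemma perp_anti a (u v : hom_to C a) :
  hom_inversions u `<=` hom_inversions v ->
  hom_inversions (perp v) `<=` hom_inversions (perp u).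
Proof. by move=> uv; rewrite !perp_inversions fsetDS. Qed.

Lemma perp_swap a (u v : hom_to C a) :
  (hom_inversions u `<=` hom_inversions (perp v)) =
  (hom_inversions v `<=` hom_inversions (perp u)).
Proof. by apply/idP/idP => /perp_anti; rewrite perpK. Qed.

Lemma exists_hom_join a (u v : hom_to C a) : exists w : hom_to C a, forall e : hom_to C a,
  (hom_inversions w `<=` hom_inversions e) =
  (hom_inversions u `<=` hom_inversions e) && (hom_inversions v `<=` hom_inversions e).
Proof.
have [s [us vs sE]] := exists_join a (hom_word u) (hom_word v).
exists (word_hom a s) => e; rewrite hom_inversions_word.
apply/idP/andP => [se|[ue ve]]; last exact: sE.
by split; [apply: fsubset_trans us se|apply: fsubset_trans vs se].
Qed.

Section WeakOrder.
Variables (d : Order.disp_t) (a : A).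

(* The unused arguments let the instances below be inferred from the type. *)
Definition weak_order of Order.disp_t & is_finite_root_system C (real_roots C) : Type :=
  hom_to C a.
Local Notation L := (weak_order d hfin).
HB.instance Definition _ := Choice.on L.

(** The boolean form of [weak_le], justified by [weak_leE]. *)
Definition weak_leb (u v : L) := hom_inversions u `<=` hom_inversions v.

Fact weak_leb_refl : reflexive weak_leb.
Proof. by move=> u; apply: fsubset_refl. Qed.

Fact weak_leb_anti : antisymmetric weak_leb.
Proof. by move=> u v uv; apply/hom_inversions_inj/eqP; rewrite eqEfsubset. Qed.

Fact weak_leb_trans : transitive weak_leb.
Proof. by move=> v u w; apply: fsubset_trans. Qed.

HB.instance Definition _ :=
  Order.Le_isPOrder.Build d L weak_leb_refl weak_leb_anti weak_leb_trans.

Fact weak_leb_inversions (u v : L) :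
  (u <= v)%O = (hom_inversions u `<=` hom_inversions v).
Proof. by []. Qed.

Definition weak_join (u v : L) : L := sval (cid (exists_hom_join u v)).
(** De Morgan's law, as [perp] is an order-reversing involution. *)
Definition weak_meet (u v : L) : L := perp (weak_join (perp u) (perp v)).

Fact weak_joinP (u v w : L) : (weak_join u v <= w)%O = (u <= w)%O && (v <= w)%O.
Proof. exact: (svalP (cid (exists_hom_join u v))). Qed.

Fact weak_meetP (u v w : L) : (u <= weak_meet v w)%O = (u <= v)%O && (u <= w)%O.
Proof.
rewrite [LHS]perp_swap [LHS](weak_joinP _ _ (perp u)).
by congr (_ && _); rewrite [LHS]perp_swap perpK.
Qed.

HB.instance Definition _ := Order.POrder_isJoinSemilattice.Build d L weak_joinP.
HB.instance Definition _ := Order.POrder_isMeetSemilattice.Build d L weak_meetP.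

Fact weak_le0 (u : L) : ((hom_to_id C a : L) <= u)%O.
Proof.
have -> : hom_to_id C a = word_hom a [::] by apply: mk_hom_to_word; rewrite /word_eq !eqxx.
by rewrite weak_leb_inversions hom_inversions_word inversions_nil fsub0set.
Qed.

Fact weak_le1 (u : L) : (u <= (longest C a : L))%O.
Proof.
by rewrite weak_leb_inversions longest_inversions hom_inversions_proots.
Qed.

HB.instance Definition _ := Order.hasBottom.Build d L weak_le0.
HB.instance Definition _ := Order.hasTop.Build d L weak_le1.

Lemma weak_order_lattice :
  is_lattice_for (Order.TBLattice.class L) (@weak_le I A C a) (hom_to_id C a) (longest C a).
Proof. by split=> // u v; rewrite weak_leE. Qed.

Lemma weak_order_orthocomplement : @is_orthocomplement d L (@perp I A C a).
Proof.
have perp_meet (w : L) : (w `&` (perp w : L))%O = \bot%O.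
  apply/le_anti; rewrite le0x andbT; set m := (_ `&` _)%O.
  have mw : (m <= w)%O by apply: leIl.
  have mp : (m <= (perp w : L))%O by apply: leIr.
  rewrite !weak_leb_inversions perp_inversions in mw mp *.
  apply/fsubsetP => x xm; have := fsubsetP mp x xm.
  by rewrite in_fsetD (fsubsetP mw).
have perp_le (u v : L) : (u <= v)%O -> ((perp v : L) <= (perp u : L))%O.
  exact: perp_anti.
split=> // [w|]; last exact: perpK.
(* The complement of the join lies below both [perp w] and [w], whose meet is the bottom;
   complementing again puts the join above the complement of the bottom, which is the top. *)
have top_le : ((perp (w `|` (perp w : L) : L) : L) <= \bot)%O.
  rewrite -(perp_meet (perp w : L)) perpK lexI.
  by rewrite !perp_le ?leUl ?leUr //= -[X in (_ <= X)%O](perpK w) perp_le ?leUr.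
apply/le_anti; rewrite lex1 /=; have := perp_le _ _ top_le; rewrite perpK.
apply: le_trans; rewrite weak_leb_inversions perp_swap.
exact: (le0x (perp (\top%O : L) : L)).
Qed.

End WeakOrder.

End Words.

Theorem theorem3p18 (d : Order.disp_t) (I A : finType) (C : cartan_scheme I A)
    (hfin : is_finite_root_system C (real_roots C)) (a : A) :
  exists M : Order.TBLattice.axioms_ d (hom_to C a),
    is_lattice_for M (@weak_le I A C a) (hom_to_id C a) (longest C a) /\
    @is_orthocomplement d (Order.TBLattice.Pack M) (@perp I A C a).
Proof.
exists (Order.TBLattice.class (weak_order a d hfin)); split.
  exact: weak_order_lattice.
exact: weak_order_orthocomplement.
Qed.
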